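(* Let $k$ be a field of characteristic zero and $n\ge 1$. The invariant integral $w_{Gl_n}$ on $Gl_n$, as a linear form on $A_{Gl_n}=k[x_{11},\ldots,x_{nn},\frac{1}{\det(x_{ij})}]$, is given as follows: for every polynomial $p(x_{ij})\in k[x_{11},\ldots,x_{nn}]$ and every integer $s\ge 0$, $$w_{Gl_n}\left(\frac{p(x_{ij})}{\det^s(x_{ij})}\right)=\frac{D^s(p_{n\cdot s}(x_{ij}))}{D^s(\det^s(x_{ij}))},$$ where $p_{n\cdot s}$ is the homogeneous component of $p$ of degree $n\cdot s$.
   Context: $A_{Gl_n}$ is the ring of functions of the linear group $Gl_n$. The invariant integral $w_{Gl_n}\in{\rm Hom}_k(A_{Gl_n},k)$ is the unique $Gl_n$-invariant linear form with $w_{Gl_n}(1)=1$. $D=\det\left(\frac{\partial}{\partial x_{ij}}\right)$ is the Cayley operator on $k[x_{11},\ldots,x_{nn}]$, a homogeneous differential operator of order $n$ with constant coefficients, so $D^s(p_{ns})$ and $D^s(\det^s(x_{ij}))$ are elements of $k$ (the latter nonzero). *)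

(* Defs.v *)
From HB Require Import structures.
From mathcomp Require Import all_boot all_fingroup all_algebra.
From mathcomp Require Import mpoly.
From Stdlib Require Import ClassicalEpsilon.

Set Implicit Arguments.
Unset Strict Implicit.
Unset Printing Implicit Defensive.

Import GRing.Theory.
Local Open Scope ring_scope.

(* R[x_11, ..., x_nn] is {mpoly R[n * n]}: the variable x_ij is the one of     *)
(* index mxvec_index i j.                                                      *)
Definition generic_mx (R : comNzRingType) (n : nat) : 'M[{mpoly R[n * n]}]_n :=
  \matrix_(i, j) 'X_(mxvec_index i j).

Definition generic_det (R : comNzRingType) (n : nat) : {mpoly R[n * n]} :=
  \det (generic_mx R n).

Lemma generic_det_neq0 (R : comNzRingType) (n : nat) : generic_det R n != 0.
Proof.
have e1: (generic_det R n).@[fun v => mxvec (1%:M : 'M[R]_n) 0 v] = 1.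
  rewrite /generic_det -det_map_mx /= -[RHS](det1 R n); congr (\det _).
  by apply/matrixP=> i j; rewrite !mxE mevalXU mxvecE mxE.
apply: contra_eq_neq e1 => ->.
by rewrite meval0 eq_sym oner_eq0.
Qed.

Section CoordinateRing.
Variables (k : fieldType) (n : nat).

Local Notation P := {mpoly k[n * n]}.
Local Notation K := {fraction P}.
Local Notation det := (generic_det k n).

Definition gl_regular : {pred K} := fun f =>
  if excluded_middle_informative
       (exists (p : P) (s : nat), f = tofrac p / tofrac det ^+ s)
  then true else false.

Lemma gl_regularP (f : K) :
  reflect (exists (p : P) (s : nat), f = tofrac p / tofrac det ^+ s)
          (f \in gl_regular).
Proof.
by rewrite unfold_in /gl_regular; case: excluded_middle_informative => h;
  constructor.
Qed.

Lemma gl_det_neq0 (s : nat) : tofrac det ^+ s != 0 :> K.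
Proof. by rewrite expf_neq0 // tofrac_eq0 generic_det_neq0. Qed.

Lemma gl_regular_subring : subring_closed gl_regular.
Proof.
split.
- by apply/gl_regularP; exists 1, 0; rewrite expr0 divr1 tofrac1.
- move=> f g /gl_regularP[p [s ->]] /gl_regularP[q [t ->]]; apply/gl_regularP.
  exists (p * det ^+ t - q * det ^+ s), (s + t)%N.
  rewrite tofracB !tofracM !tofracXn -mulNr addf_div ?gl_det_neq0 //.
  by rewrite exprD mulNr.
- move=> f g /gl_regularP[p [s ->]] /gl_regularP[q [t ->]]; apply/gl_regularP.
  by exists (p * q), (s + t)%N; rewrite tofracM exprD mulf_div.
Qed.

HB.instance Definition _ :=
  GRing.isSubringClosed.Build K gl_regular gl_regular_subring.

(* The ring k[x_11, ..., x_nn, 1/det], as a subring of k(x_11, ..., x_nn). *)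
Record gl_ring := GlRing { gl_val : K; _ : gl_val \in gl_regular }.

HB.instance Definition _ := [isSub for gl_val].
HB.instance Definition _ := [Choice of gl_ring by <:].
HB.instance Definition _ := [SubChoice_isSubComNzRing of gl_ring by <:].

Fact gl_frac_subproof (p : P) (s : nat) :
  tofrac p / tofrac det ^+ s \in gl_regular.
Proof. by apply/gl_regularP; exists p, s. Qed.

Definition gl_frac (p : P) (s : nat) : gl_ring :=
  GlRing (gl_frac_subproof p s).

Definition gl_scale (c : k) (f : gl_ring) : gl_ring := gl_frac c%:MP 0 * f.

Fact gl_scaleA a b f : gl_scale a (gl_scale b f) = gl_scale (a * b) f.
Proof.
rewrite /gl_scale mulrA; congr (_ * f); apply: val_inj.
by rewrite rmorphM /= !expr0 !divr1 -tofracM -mpolyCM.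
Qed.

Fact gl_scale1 : left_id 1 gl_scale.
Proof.
move=> f; rewrite /gl_scale -[RHS]mul1r; congr (_ * f); apply: val_inj.
by rewrite /= expr0 divr1 tofrac1.
Qed.

Fact gl_scaleDr : right_distributive gl_scale +%R.
Proof. by move=> c f g; rewrite /gl_scale mulrDr. Qed.

Fact gl_scaleDl f : {morph gl_scale^~ f : a b / a + b}.
Proof.
move=> a b; rewrite /gl_scale -mulrDl; congr (_ * f); apply: val_inj.
by rewrite [RHS]rmorphD /= !expr0 !divr1 mpolyCD tofracD.
Qed.

HB.instance Definition _ := GRing.Zmodule_isLmodule.Build k gl_ring
  gl_scaleA gl_scale1 gl_scaleDr gl_scaleDl.

Fact gl_scaleAl (c : k) (f g : gl_ring) : c *: (f * g) = c *: f * g.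
Proof. exact: mulrA. Qed.

HB.instance Definition _ :=
  GRing.Lmodule_isLalgebra.Build k gl_ring gl_scaleAl.

Fact gl_scaleAr (c : k) (f g : gl_ring) : c *: (f * g) = f * (c *: g).
Proof. exact: mulrCA. Qed.

HB.instance Definition _ :=
  GRing.Lalgebra_isAlgebra.Build k gl_ring gl_scaleAr.

(* The polynomial p(g x) in S[x_11, ..., x_nn], for g an n x n matrix over S. *)
Definition translate (S : comAlgType k) (g : 'M[S]_n) (p : P) :
    {mpoly S[n * n]} :=
  mmap (fun c : k => (c%:A : S)%:MP)
       (fun v => mxvec (map_mx (@mpolyC _ S) g *m generic_mx S n) 0 v) p.

(* The S-linear extension of w : A -> k to S[x_11, ..., x_nn, 1/det], at       *)
(* q / det^s: it maps (sum_m q_m x^m) / det^s to sum_m q_m w(x^m / det^s).      *)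
Definition extend_form (w : gl_ring -> k) (S : comAlgType k)
    (q : {mpoly S[n * n]}) (s : nat) : S :=
  \sum_(m <- msupp q) q@_m * (w (gl_frac 'X_[m] s))%:A.

(* Invariance under the group scheme Gl_n: for every commutative k-algebra S,  *)
(* every S-point g and every f = p / det^s, one has w(f(g x)) = w(f), where    *)
(* f(g x) = p(g x) / (det(g)^s det(x)^s).                                       *)
Definition gl_invariant (w : gl_ring -> k) : Prop :=
  forall (S : comUnitAlgType k) (g : 'M[S]_n), g \in unitmx ->
  forall (p : P) (s : nat),
    (\det g) ^- s * extend_form w (translate g p) s = (w (gl_frac p s))%:A.

Definition is_invariant_integral (w : {scalar gl_ring}) : Prop :=
  w 1 = 1 /\ gl_invariant w.

(* det(d/dx_ij), by the Leibniz formula. *)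
Definition cayley (p : P) : P :=
  \sum_(sigma : 'S_n)
    (-1) ^+ sigma *: p^`M[(\sum_(i < n) U_(mxvec_index i (sigma i)))%MM].

(* D^s p, read as an element of k; see iter_cayley_const. *)
Definition cayley_pow (s : nat) (p : P) : k := (iter s cayley p)@_0%MM.

Lemma cayley_homog (d : nat) (p : P) :
  p \is (n + d).-homog -> cayley p \is d.-homog.
Proof.
move=> hp; apply: rpred_sum => sigma _; apply: rpredZ.
apply/dhomogP => m; rewrite mcoeff_msupp mcoeff_mderivm => nz.
have: p@_(\sum_(i < n) U_(mxvec_index i (sigma i)) + m)%MM != 0.
  by apply: contraNneq nz => ->; rewrite mul0rn.
rewrite -mcoeff_msupp => /(dhomogP _ _ _ hp) /=; rewrite mdegD mdeg_sum.
rewrite (eq_bigr (fun=> 1%N)) => [|i _]; last exact: mdeg1.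
by rewrite sum1_card card_ord => /addnI.
Qed.

Lemma iter_cayley_const (s : nat) (p : P) :
  p \is (n * s).-homog -> iter s cayley p = (cayley_pow s p)%:MP.
Proof.
move=> hp; have: iter s cayley p \is 0.-homog.
  elim: s p hp => [|s IHs] p; first by rewrite muln0.
  by rewrite mulnS => /cayley_homog/IHs; rewrite iterSr.
move=> /dhomogP h0; apply/mpolyP => m; rewrite mcoeffC.
have [<-|m0] := eqVneq 0%MM m; first by rewrite mulr1.
rewrite mulr0; apply/eqP; apply: contraNT m0; rewrite -mcoeff_msupp => /h0 /=.
by move/eqP; rewrite mdeg_eq0 eq_sym.
Qed.

End CoordinateRing.

(* Main.v *)
Require Import Defs.
From HB Require Import structures.
From mathcomp Require Import all_boot all_fingroup all_algebra.
From mathcomp Require Import ssrcomplements mpoly.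

Set Implicit Arguments.
Unset Strict Implicit.
Unset Printing Implicit Defensive.

Import GRing.Theory Num.Theory.
Local Open Scope ring_scope.

(** The proof rests on the apolar pairing on k[x_11, ..., x_nn]: the symmetric
    bilinear form in which distinct monomials are orthogonal and x^m pairs with
    itself to m! (the product of the factorials of the exponents), in other
    words <p, q> is the value at 0 of p(d/dx) q.  Multiplication by p is adjoint
    to p(d/dx) (apolar_mulXm), so multiplication by det is adjoint to the Cayley
    operator D, and D^s p, for p homogeneous of degree n * s, is the number
    <det^s, p>; the other homogeneous components of a polynomial are orthogonal
    to det^s.  The formula to be proved is therefore
      w(p / det^s) = <det^s, p> / <det^s, det^s>.
    The denominator is nonzero in characteristic zero: it is the image of an
    integer which is a sum of positive terms (apolar_det_neq0).

    Invariance is a formal consequence: the adjoint of the substitution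
    x |-> g x is x |-> g^T x (apolar_lin_subst), and det(g^T x)^s is
    det(g)^s det(x)^s.

    Both the uniqueness of w and the fact that the formula depends only on the
    fraction p / det^s follow from one statement (semi_invariant_proportional):
    every linear form phi on polynomials with phi(p(g x)) = det(g)^s phi(p) is
    proportional to <det^s, .>.  Indeed, in bounded degree, phi is the pairing
    with a polynomial f, and adjointness turns the hypothesis into
    f(g^T x) = det(g)^s f(x); at x = 1 with g^T a matrix of indeterminates this
    reads f = f(1) det^s.  Uniqueness is the case phi(p) = w(p / det^s).
    Independence of the representative is the case
    phi(p) = <det^(s+t), det^t p>: this phi is proportional to <det^s, .>, and
    the factor is found by taking p = det^s. *)

(** * The apolar pairing *)

Section Apolar.
Variables (N : nat) (R : comNzRingType).
Local Notation P := {mpoly R[N]}.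
Implicit Types (p q : P) (m b : 'X_{1..N}).

(** The linear form on polynomials taking the value h m at the monomial x^m. *)
Definition mlin (h : 'X_{1..N} -> R) (q : P) : R :=
  \sum_(m <- msupp q) q@_m * h m.

Section Mlin.
Variable h : 'X_{1..N} -> R.

(** Sums over a fixed range of monomials allow several polynomials to be
    compared term by term. *)
Lemma mlin_bounded d q : (msize q <= d)%N ->
  mlin h q = \sum_(m : 'X_{1..N < d}) q@_m * h m.
Proof.
move=> le_qd; rewrite /mlin.
rewrite (big_mksub 'X_{1..N < d}) ?msupp_uniq //=; last first.
  by move=> x /msize_mdeg_lt /leq_trans; apply.
by rewrite big_rmcond //= => j /memN_msupp_eq0 ->; rewrite mul0r.
Qed.

Fact mlin_is_scalar : scalar (mlin h).
Proof.
move=> c p q; pose d := maxn (maxn (msize p) (msize q)) (msize (c *: p + q)).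
rewrite !(@mlin_bounded d) ?leq_max ?leqnn ?orbT //.
rewrite mulr_sumr -big_split; apply: eq_bigr => m _ /=.
by rewrite mcoeffD mcoeffZ mulrDl mulrA.
Qed.

HB.instance Definition _ := GRing.isLinear.Build R P R *%R (mlin h)
  mlin_is_scalar.

Lemma mlinX m : mlin h 'X_[m] = h m.
Proof. by rewrite /mlin msuppX big_seq1 mcoeffX eqxx mul1r. Qed.

End Mlin.

Lemma mlin_monomials (f : {scalar P}) q : mlin (fun m => f 'X_[m]) q = f q.
Proof.
rewrite [in RHS](mpolyE q) linear_sum; apply: eq_bigr => m _.
by rewrite linearZ.
Qed.

Definition mfact m : nat := (\prod_(i < N) (m i)`!)%N.

Definition apolar p q : R := mlin (fun m => p@_m * (mfact m)%:R) q.

HB.instance Definition _ p := GRing.Linear.copy (apolar p)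
  (mlin (fun m => p@_m * (mfact m)%:R)).

Lemma apolarC p q : apolar p q = apolar q p.
Proof.
pose d := maxn (msize p) (msize q).
rewrite /apolar !(@mlin_bounded _ d) ?leq_max ?leqnn ?orbT //.
by apply: eq_bigr => m _; rewrite mulrCA.
Qed.

Lemma apolarX p m : apolar p 'X_[m] = p@_m * (mfact m)%:R.
Proof. exact: mlinX. Qed.

Lemma apolarDl p1 p2 q : apolar (p1 + p2) q = apolar p1 q + apolar p2 q.
Proof. by rewrite !(apolarC _ q) linearD. Qed.

Lemma apolarZl c p q : apolar (c *: p) q = c * apolar p q.
Proof. by rewrite !(apolarC _ q) linearZ. Qed.

Lemma apolar1 q : apolar 1 q = q@_0%MM.
Proof.
rewrite apolarC -mpolyX0 apolarX [mfact _]big1 ?mulr1 // => i _.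
by rewrite mnm0E.
Qed.

(** Monomials of different degrees are orthogonal. *)
Lemma apolar_homog d u p :
  u \is d.-homog -> apolar u (pihomog mdeg d p) = apolar u p.
Proof.
move=> hu; rewrite [in RHS](mpolyE p) !linear_sum big_mkcond.
apply: eq_bigr => m _ /=; case: eqP => // /eqP md.
by rewrite linearZ /= apolarX (dhomog_nemf_coeff hu md) mul0r mulr0.
Qed.

Lemma mfactD m b :
  mfact (m + b)%MM = (\prod_(i < N) (m + b)%MM i ^_ (m i) * mfact b)%N.
Proof.
rewrite /mfact -big_split; apply: eq_bigr => i _ /=.
by rewrite mnmDE -[in LHS](ffact_fact (leq_addr (b i) (m i))) addKn.
Qed.

(** On monomials this is (m + a)! = ((m + a)! / a!) a!, the quotient being the
    coefficient produced by the derivation. *)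
Lemma apolar_mulXm m p q : apolar ('X_[m] * p) q = apolar p q^`M[m].
Proof.
rewrite !(apolarC _ q) (apolarC _ q^`M[m]) (mpolyE p) mulr_sumr !linear_sum.
apply: eq_bigr => a _; rewrite -scalerAr !linearZ /=; congr (_ * _).
rewrite -mpolyXD !apolarX mcoeff_mderivm mfactD natrM.
by rewrite -[q@__ *+ _]mulr_natr mulrA.
Qed.

Lemma mpoly_mulX_ind (T : P -> Prop) :
  T 1 -> (forall v p, T p -> T ('X_v * p)) ->
  (forall p q, T p -> T q -> T (p + q)) -> (forall c p, T p -> T (c *: p)) ->
  forall p, T p.
Proof.
move=> T1 TX TD TZ; have TXm m : T 'X_[m].
  rewrite mpolyXE_id.
  elim: (index_enum _) => [|v r IHr]; first by rewrite big_nil.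
  rewrite big_cons; elim: (m v) => [|e IHe]; first by rewrite mul1r.
  by rewrite exprS -mulrA; apply: TX.
elim/mpolyind=> [|c m p _ _ Tp]; first by rewrite -(scale0r 1); apply: TZ.
by apply: TD => //; apply: TZ.
Qed.

Definition lin_form (A : 'M[R]_N) v : P := \sum_u A v u *: 'X_u.

Definition lin_subst (A : 'M[R]_N) (p : P) : P :=
  mmap (@mpolyC N R) (lin_form A) p.

HB.instance Definition _ A := GRing.RMorphism.copy (lin_subst A)
  (mmap (@mpolyC N R) (lin_form A)).

Lemma lin_substZ A c p : lin_subst A (c *: p) = c *: lin_subst A p.
Proof. by rewrite /lin_subst mmapZ mul_mpolyC. Qed.

Lemma lin_substX A v : lin_subst A 'X_v = lin_form A v.
Proof. by rewrite /lin_subst mmapX mmap1U. Qed.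

Lemma mderivXU v w : ('X_w : P)^`M(v) = ((w == v)%:R)%:MP.
Proof.
rewrite mderivX mnm1E -mul_mpolyC; case: eqP => [->|_].
  suff ->: (U_(v) - U_(v))%MM = 0%MM :> 'X_{1..N} by rewrite mpolyX0 mulr1.
  by apply/mnmP => i; rewrite mnmBE subnn mnm0E.
by rewrite mpolyC0 mul0r.
Qed.

(** The chain rule for the linear change of variables x |-> A x. *)
Lemma mderiv_lin_subst A v p :
  (lin_subst A p)^`M(v) = \sum_u A u v *: lin_subst A p^`M(u).
Proof.
elim/mpoly_mulX_ind: p => [|w p IHp|p q IHp IHq|c p IHp].
- rewrite rmorph1 -mpolyC1 mderivC big1 // => u _.
  by rewrite mderivC raddf0 scaler0.
- have Dw: (lin_form A w)^`M(v) = (A w v)%:MP.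
    rewrite linear_sum (bigD1 v) //= big1 => [|u /negbTE uv].
      by rewrite linearZ /= mderivXU eqxx addr0 -mul_mpolyC mulr1.
    by rewrite linearZ /= mderivXU uv scaler0.
  rewrite rmorphM /= mderivM IHp lin_substX Dw mul_mpolyC.
  rewrite [lin_form A w * _]mulr_sumr.
  rewrite [RHS](eq_bigr (fun u => (A u v * (w == u)%:R) *: lin_subst A p
     + lin_form A w * (A u v *: lin_subst A p^`M(u)))); last first.
    move=> u _; rewrite mderivM mderivXU rmorphD !rmorphM /= lin_substX.
    rewrite [lin_subst A _%:MP]mmapC scalerDr -scalerAr mul_mpolyC.
    by rewrite scalerA.
  rewrite big_split /= -scaler_suml; congr (_ + _).
  rewrite (bigD1 w) //= eqxx mulr1 big1 ?addr0 // => u.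
  by rewrite eq_sym => /negbTE->; rewrite mulr0.
- rewrite rmorphD linearD /= IHp IHq -big_split; apply: eq_bigr => u _ /=.
  by rewrite linearD rmorphD scalerDr.
- rewrite lin_substZ linearZ /= IHp scaler_sumr; apply: eq_bigr => u _.
  by rewrite mderivZ lin_substZ !scalerA mulrC.
Qed.

(** By induction on p: a factor x_v of p moves to the right-hand side as a
    derivation, which the chain rule turns into a combination of derivations
    with coefficients in the column v of A; moved back, they become the linear
    form which A^T substitutes for x_v.  For p = 1 both sides are the constant
    term of q. *)
Lemma apolar_lin_subst A p q :
  apolar p (lin_subst A q) = apolar (lin_subst A^T p) q.
Proof.
elim/mpoly_mulX_ind: p q => [|v p IHp|p p' IHp IHp'|c p IHp] q.
- rewrite rmorph1; elim/mpoly_mulX_ind: q => [|v q IHq|q q' IHq IHq'|c q IHq].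
  + by rewrite rmorph1.
  + rewrite rmorphM /= lin_substX ![apolar 1 _]apolarC apolar_mulXm.
    rewrite -!mpolyC1 mderivmU1m mderivC linear0.
    rewrite mulr_suml apolarC linear_sum big1 // => u _.
    rewrite -scalerAl linearZ /= apolarC apolar_mulXm mderivmU1m mderivC.
    by rewrite linear0 mulr0.
  + by rewrite rmorphD !linearD /= IHq IHq'.
  + by rewrite lin_substZ !linearZ /= IHq.
- rewrite apolar_mulXm mderivmU1m mderiv_lin_subst linear_sum.
  rewrite rmorphM /= lin_substX mulr_suml apolarC linear_sum.
  apply: eq_bigr => u _; rewrite linearZ /= IHp -scalerAl linearZ /= mxE.
  by rewrite [apolar q _]apolarC apolar_mulXm mderivmU1m.
- by rewrite rmorphD !apolarDl IHp IHp'.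
- by rewrite lin_substZ !apolarZl IHp.
Qed.

Lemma lin_subst_homog A d p : p \is d.-homog -> lin_subst A p \is d.-homog.
Proof.
move=> /dhomogP hp; rewrite /lin_subst /mmap big_seq.
apply: rpred_sum => m /hp <-; rewrite mul_mpolyC; apply: rpredZ.
rewrite /mmap1 /= mdegE.
elim/big_rec2: _ => [|v p' d' _ hp']; first exact: dhomog1.
apply: dhomogM => //; have lin1 : lin_form A v \is 1.-homog.
  by apply: rpred_sum => u _; apply: rpredZ; rewrite dhomogX /= mdeg1.
by have := dhomogMn (m v) lin1; rewrite mul1n.
Qed.

Lemma msize_lin_subst A p : (msize (lin_subst A p) <= msize p)%N.
Proof.
rewrite {1}(mpolyE p) rmorph_sum /= big_seq.
elim/big_ind: _ => [|q q' hq hq'|m mp]; first by rewrite msize0.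
  by apply: leq_trans (msizeD_le _ _) _; rewrite geq_max hq.
rewrite lin_substZ; apply: leq_trans (msizeZ_le _ _) _.
have /dhomogP hm : lin_subst A 'X_[m] \is (mdeg m).-homog.
  by rewrite lin_subst_homog // dhomogX /=.
rewrite msizeE big_seq; elim/big_ind: _ => // [a b|m' /hm /= ->].
  by rewrite geq_max => -> ->.
exact: msize_mdeg_lt.
Qed.

End Apolar.

(** * Change of coefficients *)

Section MapApolar.
Variables (N : nat) (R S : comNzRingType) (f : {rmorphism R -> S}).
Local Notation P := {mpoly R[N]}.

Lemma msize_map_mpoly (p : P) : (msize (map_mpoly f p) <= msize p)%N.
Proof.
rewrite msizeE big_seq; elim/big_ind: _ => // [a b|m].
  by rewrite geq_max => -> ->.
rewrite mcoeff_msupp mcoeff_map_mpoly => fm; apply: msize_mdeg_lt.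
by rewrite mcoeff_msupp; apply: contra_neq fm => ->; apply: rmorph0.
Qed.

Lemma map_mpoly_mlin h (q : P) :
  mlin (f \o h) (map_mpoly f q) = f (mlin h q).
Proof.
rewrite [in LHS](mpolyE q) rmorph_sum linear_sum [in RHS]/mlin raddf_sum.
apply: eq_bigr => m _ /=.
by rewrite map_mpolyZ linearZ rmorphM /= map_mpolyX mlinX.
Qed.

Lemma map_mpoly_apolar (p q : P) :
  apolar (map_mpoly f p) (map_mpoly f q) = f (apolar p q).
Proof.
rewrite /apolar -map_mpoly_mlin /mlin; apply: eq_bigr => m _ /=.
by rewrite !mcoeff_map_mpoly rmorphM rmorph_nat.
Qed.

Lemma meval_map_mpoly (v : 'I_N -> R) (p : P) :
  (map_mpoly f p).@[f \o v] = f p.@[v].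
Proof.
elim/mpoly_mulX_ind: p => [|u p IHp|p q IHp IHq|c p IHp].
- by rewrite !rmorph1.
- by rewrite !rmorphM /= IHp map_mpolyX !mevalXU.
- by rewrite !rmorphD /= IHp IHq.
- by rewrite map_mpolyZ !mevalZ IHp rmorphM.
Qed.

End MapApolar.

(** * Linear forms: base change and representation by the pairing *)

Section LinearForms.
Variables (k : fieldType) (N : nat).
Local Notation P := {mpoly k[N]}.

(** The S-linear extension of phi. *)
Definition base_change (S : comAlgType k) (phi : P -> k)
    (q : {mpoly S[N]}) : S :=
  mlin (fun m => (phi 'X_[m])%:A) q.

Lemma base_change_map (S : comAlgType k) (phi : {scalar P}) (p : P) :
  base_change phi (map_mpoly (in_alg S) p) = (phi p)%:A.
Proof.
rewrite -[in RHS](mlin_monomials phi p).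
exact: (map_mpoly_mlin (in_alg S) (fun m => phi 'X_[m])).
Qed.

Lemma base_change_apolar (S : comAlgType k) (u : P) (q : {mpoly S[N]}) :
  base_change (apolar u) q = apolar (map_mpoly (in_alg S) u) q.
Proof.
apply: eq_bigr => m _; rewrite apolarX mcoeff_map_mpoly /=.
by rewrite -[(_ * _)%:A]/(in_alg S _) rmorphM rmorph_nat.
Qed.

Lemma base_change_mulr (S : comAlgType k) (phi psi : P -> k) a :
  (forall p, phi p = psi p * a) ->
  forall q : {mpoly S[N]}, base_change phi q = base_change psi q * a%:A.
Proof.
move=> phiE q; rewrite /base_change /mlin mulr_suml; apply: eq_bigr => m _.
by rewrite phiE -!in_algE rmorphM mulrA.
Qed.

Hypothesis char0 : [pchar k] =i pred0.

Lemma mfact_neq0 (m : 'X_{1..N}) : (mfact m)%:R != 0 :> k.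
Proof.
by rewrite (pcharf0P k).1 // -lt0n prodn_gt0 // => i; apply: fact_gt0.
Qed.

(** The polynomial of degree less than d whose pairing with the polynomials of
    degree less than d is phi. *)
Definition dual_poly d (phi : P -> k) : P :=
  \sum_(m : 'X_{1..N < d}) (phi 'X_[m] / (mfact m)%:R) *: 'X_[m].

Lemma msize_dual_poly d phi : (msize (dual_poly d phi) <= d)%N.
Proof.
rewrite /dual_poly.
elim/big_ind: _ => [|p q hp hq|m _]; first by rewrite msize0.
  by apply: leq_trans (msizeD_le _ _) _; rewrite geq_max hp.
by apply: leq_trans (msizeZ_le _ _) _; rewrite msizeX bmdeg.
Qed.

Lemma mcoeff_dual_poly d phi m : (mdeg m < d)%N ->
  (dual_poly d phi)@_m * (mfact m)%:R = phi 'X_[m].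
Proof.
move=> md; rewrite (mcoeff_mpoly (fun m => phi 'X_[m] / (mfact m)%:R)) //.
by rewrite divfK ?mfact_neq0.
Qed.

Lemma apolar_dual_poly d (phi : {scalar P}) q : (msize q <= d)%N ->
  apolar (dual_poly d phi) q = phi q.
Proof.
move=> hq; rewrite -[RHS](mlin_monomials phi q) /apolar !(mlin_bounded _ hq).
by apply: eq_bigr => m _; rewrite mcoeff_dual_poly ?bmdeg.
Qed.

Lemma base_change_dual_poly (S : comAlgType k) d phi (q : {mpoly S[N]}) :
  (msize q <= d)%N ->
  apolar (map_mpoly (in_alg S) (dual_poly d phi)) q = base_change phi q.
Proof.
move=> hq; rewrite -base_change_apolar /base_change !(mlin_bounded _ hq).
by apply: eq_bigr => m _; rewrite apolarX mcoeff_dual_poly ?bmdeg.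
Qed.

End LinearForms.

(** * The action of matrices by left multiplication *)

Section LeftMultiplication.
Variables (n : nat) (R : comNzRingType).
Local Notation P := {mpoly R[n * n]}.
Local Notation X := (generic_mx R n).
Local Notation det := (generic_det R n).
Implicit Types (g : 'M[R]_n) (p : P).

(** The matrix of M |-> g M on entries.  The transpose is there because
    lin_mulmx acts on row vectors, whereas lin_subst A replaces the variable v
    by the form with coefficients in the row v of A. *)
Definition lmul_mx g : 'M[R]_(n * n) := (lin_mulmx g)^T.

Lemma lmul_mxE g i j i' j' :
  lmul_mx g (mxvec_index i j) (mxvec_index i' j') = g i i' *+ (j' == j).
Proof.
rewrite !mxE /= vec_mx_delta mxvecE mxE (bigD1 i') //= big1 => [|l /negbTE li'].
  by rewrite addr0 mxE eqxx /= eq_sym mulr_natr.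
by rewrite mxE li' mulr0.
Qed.

(** This identifies the adjoint of x |-> g x with x |-> g^T x. *)
Lemma lmul_mx_tr g : lmul_mx g^T = (lmul_mx g)^T.
Proof.
apply/matrixP; case/mxvec_indexP=> i j; case/mxvec_indexP=> i' j'.
by rewrite [RHS]mxE !lmul_mxE mxE eq_sym.
Qed.

Lemma lin_form_lmul g v :
  lin_form (lmul_mx g) v = mxvec (map_mx (@mpolyC _ R) g *m X) 0 v.
Proof.
have map_g : map_mx (@mpolyC (n * n) R) (lin_mulmx g) =
    lin_mulmx (map_mx (@mpolyC (n * n) R) g) :> 'M_(n * n).
  by apply: map_lin_mx => M; rewrite map_mxM.
rewrite -[mxvec _]mul_vec_lin -/(lin_mulmx _) -map_g mxE; apply: eq_bigr => u _.
rewrite [map_mx _ _ u v]mxE mulrC.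
rewrite -[lmul_mx g v u]/((lin_mulmx g)^T v u) [_^T _ _]mxE.
rewrite mul_mpolyC; congr (_ *: _).
by case/mxvec_indexP: u => i j; rewrite mxvecE mxE.
Qed.

Lemma lin_subst_generic g :
  map_mx (lin_subst (lmul_mx g)) X = map_mx (@mpolyC _ R) g *m X.
Proof.
by apply/matrixP => i j; rewrite !mxE lin_substX lin_form_lmul mxvecE mxE.
Qed.

Lemma lin_subst_det g s :
  lin_subst (lmul_mx g) (det ^+ s) = \det g ^+ s *: det ^+ s.
Proof.
rewrite rmorphXn /= -[lin_subst _ det]det_map_mx lin_subst_generic det_mulmx.
by rewrite det_map_mx exprMn -rmorphXn mul_mpolyC.
Qed.

Definition entries g : 'I_(n * n) -> R := fun v => mxvec g 0 v.

Lemma meval_generic g : map_mx (meval (entries g)) X = g.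
Proof. by apply/matrixP => i j; rewrite !mxE mevalXU /entries mxvecE. Qed.

Lemma meval_lin_subst g p :
  (lin_subst (lmul_mx g) p).@[entries 1%:M] = p.@[entries g].
Proof.
elim/mpoly_mulX_ind: p => [|v p IHp|p q IHp IHq|c p IHp].
- by rewrite !rmorph1.
- rewrite rmorphM !mevalM IHp /= mevalXU lin_substX lin_form_lmul.
  congr (_ * _).
  case/mxvec_indexP: v => i j; rewrite mxvecE.
  have evalE :
      map_mx (meval (entries 1%:M)) (map_mx (@mpolyC (n * n) R) g *m X) = g.
    rewrite map_mxM meval_generic mulmx1.
    by apply/matrixP => a b; rewrite !mxE /= mevalC.
  by rewrite /entries mxvecE -[in RHS]evalE [RHS]mxE.
- by rewrite !rmorphD /= IHp IHq.
- by rewrite lin_substZ !mevalZ IHp.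
Qed.

Lemma generic_detE : det =
  \sum_(sigma : 'S_n)
    (-1) ^+ sigma *: 'X_[(\sum_(i < n) U_(mxvec_index i (sigma i)))%MM].
Proof.
apply: eq_bigr => sigma _; rewrite -mul_mpolyC rmorphXn rmorphN rmorph1.
rewrite -mprodXE; congr (_ * _); apply: eq_bigr => i _; exact: mxE.
Qed.

Lemma generic_det_homog s : det ^+ s \is (n * s).-homog.
Proof.
apply: dhomogMn; rewrite generic_detE; apply: rpred_sum => sigma _.
apply: rpredZ; rewrite dhomogX /= mdeg_sum (eq_bigr (fun=> 1%N)) => [|i _].
  by rewrite sum1_card card_ord.
exact: mdeg1.
Qed.

End LeftMultiplication.

Lemma map_generic_det (R S : comNzRingType) (f : {rmorphism R -> S}) n s :
  map_mpoly f (generic_det R n ^+ s) = generic_det S n ^+ s.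
Proof.
rewrite rmorphXn /= -[map_mpoly f _]det_map_mx; congr (\det _ ^+ s).
by apply/matrixP => i j; rewrite !mxE /= map_mpolyX.
Qed.

(** * The Cayley operator as the adjoint of multiplication by the determinant *)

Section Cayley.
Variables (k : fieldType) (n : nat).
Local Notation det := (generic_det k n).

Lemma apolar_cayley (p q : {mpoly k[n * n]}) :
  apolar (det * p) q = apolar p (cayley q).
Proof.
rewrite generic_detE mulr_suml apolarC linear_sum [RHS]linear_sum.
apply: eq_bigr => sigma _.
by rewrite -scalerAl !linearZ /= apolarC apolar_mulXm.
Qed.

Lemma cayley_powE s (p : {mpoly k[n * n]}) :
  cayley_pow s p = apolar (det ^+ s) p.
Proof.
elim: s p => [|s IHs] p; first by rewrite expr0 apolar1.
by rewrite /cayley_pow iterSr [LHS]IHs exprS apolar_cayley.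
Qed.

Hypothesis char0 : [pchar k] =i pred0.

(** Over the integers <D, D> is the sum of m! D_m^2 over the monomials of D,
    hence positive when D is nonzero; det^s has integer coefficients. *)
Lemma apolar_det_neq0 s : apolar (det ^+ s) (det ^+ s) != 0.
Proof.
pose D : {mpoly int[n * n]} := generic_det int n ^+ s.
have D_gt0 : 0 < apolar D D.
  have /mlead_supp leadD : D != 0 by rewrite expf_neq0 ?generic_det_neq0.
  have ge0 m : 0 <= D@_m * (D@_m * (mfact m)%:R).
    by rewrite mulrA mulr_ge0 ?sqr_ge0 // -expr2 sqr_ge0.
  rewrite /apolar /mlin (bigD1_seq _ leadD) ?msupp_uniq //=.
  apply: ltr_wpDr; first exact: sumr_ge0.
  rewrite mulrA mulr_gt0 //.
    by rewrite -expr2 exprn_even_gt0 //= -mcoeff_msupp.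
  by rewrite ltr0n prodn_gt0 // => i; apply: fact_gt0.
rewrite -(map_generic_det (intmul 1) n s) map_mpoly_apolar.
move: D_gt0; case: (apolar D D) => // a a_gt0 /=.
by rewrite -pmulrn (pcharf0P k).1 // -lt0n.
Qed.
End Cayley.

(** * The generic matrix *)

Section FunctionField.
Variables (k : fieldType) (n : nat).
Local Notation P := {mpoly k[n * n]}.

(** A copy of k(x_11, ..., x_nn), to carry its structure of k-algebra. *)
Definition gl_field : Type := {fraction P}.

HB.instance Definition _ := GRing.Field.on gl_field.

Definition to_gl_field (p : P) : gl_field := tofrac p.
HB.instance Definition _ := GRing.RMorphism.copy to_gl_field (@tofrac P).

Definition gl_field_scale (c : k) (f : gl_field) : gl_field :=
  to_gl_field c%:MP * f.

Fact gl_field_scaleA a b f :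
  gl_field_scale a (gl_field_scale b f) = gl_field_scale (a * b) f.
Proof. by rewrite /gl_field_scale mulrA -rmorphM -mpolyCM. Qed.

Fact gl_field_scale1 : left_id 1 gl_field_scale.
Proof. by move=> f; rewrite /gl_field_scale rmorph1 mul1r. Qed.

Fact gl_field_scaleDr : right_distributive gl_field_scale +%R.
Proof. by move=> c f g; rewrite /gl_field_scale mulrDr. Qed.

Fact gl_field_scaleDl f : {morph gl_field_scale^~ f : a b / a + b}.
Proof. by move=> a b; rewrite /gl_field_scale mpolyCD rmorphD mulrDl. Qed.

HB.instance Definition _ := GRing.Zmodule_isLmodule.Build k gl_field
  gl_field_scaleA gl_field_scale1 gl_field_scaleDr gl_field_scaleDl.

Fact gl_field_scaleAl (c : k) (f g : gl_field) : c *: (f * g) = c *: f * g.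
Proof. exact: mulrA. Qed.

HB.instance Definition _ :=
  GRing.Lmodule_isLalgebra.Build k gl_field gl_field_scaleAl.

Fact gl_field_scaleAr (c : k) (f g : gl_field) : c *: (f * g) = f * (c *: g).
Proof. exact: mulrCA. Qed.

HB.instance Definition _ :=
  GRing.Lalgebra_isAlgebra.Build k gl_field gl_field_scaleAr.

(** The existence of the algebra, rather than the algebra itself, is what the
    sequel refers to: its elements are then opaque, and no conversion unfolds
    the quotient that defines fractions. *)
Lemma rational_function_algebra :
  exists (S : comUnitAlgType k) (iota : {rmorphism P -> S}),
    [/\ injective iota, forall c, iota c%:MP = c%:A &
        forall p, p != 0 -> iota p \is a GRing.unit].
Proof.
exists gl_field, to_gl_field; split.
- by move=> p q /eqP; rewrite tofrac_eq => /eqP.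
- by move=> c; apply/esym/mulr1.
- by move=> p p_neq0; rewrite unitfE tofrac_eq0.
Qed.

End FunctionField.

Section GenericPoint.
Variables (k : fieldType) (n : nat) (S : comUnitAlgType k).
Local Notation P := {mpoly k[n * n]}.
Variable iota : {rmorphism P -> S}.
Hypothesis iotaC : forall c, iota c%:MP = c%:A.

Definition generic_pt : 'M[S]_n := map_mx iota (generic_mx k n).

Lemma meval_generic_pt (p : P) :
  (map_mpoly (in_alg S) p).@[entries generic_pt] = iota p.
Proof.
elim/mpoly_mulX_ind: p => [|v p IHp|p q IHp IHq|c p IHp].
- by rewrite !rmorph1.
- rewrite !rmorphM /= IHp map_mpolyX mevalXU; congr (_ * _).
  by case/mxvec_indexP: v => i j; rewrite /entries mxvecE !mxE.
- by rewrite !rmorphD /= IHp IHq.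
- by rewrite map_mpolyZ mevalZ IHp -mul_mpolyC rmorphM /= iotaC.
Qed.

End GenericPoint.

(** * Semi-invariant linear forms on polynomials *)

Section SemiInvariants.
Variables (k : fieldType) (n : nat).
Local Notation P := {mpoly k[n * n]}.
Local Notation det := (generic_det k n).

Definition semi_invariant (s : nat) (phi : P -> k) : Prop :=
  forall (S : comUnitAlgType k) (g : 'M[S]_n), g \in unitmx -> forall p : P,
    base_change phi (translate g p) = \det g ^+ s * (phi p)%:A.

Lemma translateE (S : comAlgType k) (g : 'M[S]_n) (p : P) :
  translate g p = lin_subst (lmul_mx g) (map_mpoly (in_alg S) p).
Proof.
rewrite [in RHS](mpolyE p) (rmorph_sum (map_mpoly _)).
rewrite (rmorph_sum (lin_subst _)).
rewrite /translate /mmap; apply: eq_bigr => m _ /=.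
rewrite map_mpolyZ lin_substZ map_mpolyX -mul_mpolyC; congr (_ * _).
rewrite /lin_subst mmapX; apply: mmap1_eq => v; exact/esym/lin_form_lmul.
Qed.

Lemma apolar_det_translate (S : comUnitAlgType k) (g : 'M[S]_n) s
    (q : {mpoly S[n * n]}) :
  apolar (generic_det S n ^+ s) (lin_subst (lmul_mx g) q) =
    \det g ^+ s * apolar (generic_det S n ^+ s) q.
Proof.
by rewrite apolar_lin_subst -lmul_mx_tr lin_subst_det det_tr apolarZl.
Qed.

(** The pairing attached to p / det^s when it is written with the denominator
    det^(s+t). *)
Definition det_pairing s t (p : P) : k :=
  apolar (det ^+ (s + t)) (det ^+ t * p).

Fact det_pairing_is_scalar s t : scalar (det_pairing s t).
Proof. by move=> c p q; rewrite /det_pairing mulrDr -scalerAr linearP. Qed.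

HB.instance Definition _ s t := GRing.isLinear.Build k P k *%R
  (det_pairing s t) (det_pairing_is_scalar s t).

Lemma base_change_det_pairing (S : comAlgType k) s t (q : {mpoly S[n * n]}) :
  base_change (det_pairing s t) q =
    apolar (generic_det S n ^+ (s + t)) (generic_det S n ^+ t * q).
Proof.
rewrite [in RHS](mpolyE q) mulr_sumr linear_sum; apply: eq_bigr => m _ /=.
rewrite -[in RHS]scalerAr [RHS]linearZ /=; congr (_ * _).
rewrite -[_%:A]/(in_alg S _).
rewrite /det_pairing -map_mpoly_apolar rmorphM /= map_mpolyX.
by rewrite !map_generic_det.
Qed.

(** The determinant of g occurs with exponent s + t in the transform of the
    pairing with det^(s+t), and det^t p(g x) lacks a factor det(g)^t from being
    the transform of det^t p. *)
Lemma det_pairing_semi_invariant s t : semi_invariant s (det_pairing s t).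
Proof.
move=> S g gU p; rewrite translateE base_change_det_pairing.
have detU : \det g ^+ t \is a GRing.unit by rewrite unitrX -?unitmxE.
apply: (mulrI detU); rewrite -linearZ /= scalerAl -lin_subst_det -rmorphM.
rewrite apolar_det_translate addnC exprD -mulrA; congr (_ * (_ * _)).
by rewrite addnC -base_change_det_pairing base_change_map.
Qed.

Lemma apolar_det_semi_invariant s : semi_invariant s (apolar (det ^+ s)).
Proof.
move=> S g gU p; rewrite translateE base_change_apolar map_generic_det.
by rewrite apolar_det_translate -(map_generic_det (in_alg S)) map_mpoly_apolar.
Qed.

Hypothesis char0 : [pchar k] =i pred0.

(** The polynomial f that represents phi satisfies f(X x) = det(X)^s f(x) for
    the generic matrix X, by adjointness and the semi-invariance of phi under
    X^T.  Evaluation at x = 1 gives f = f(1) det^s. *)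
Lemma semi_invariant_proportional s (phi : {scalar P}) : semi_invariant s phi ->
  forall p, phi p * apolar (det ^+ s) (det ^+ s) =
            phi (det ^+ s) * apolar (det ^+ s) p.
Proof.
move=> phi_inv p; pose d := maxn (msize p) (msize (det ^+ s)).
pose f := dual_poly d phi.
have phiE q : (msize q <= d)%N -> phi q = apolar f q.
  by move/(apolar_dual_poly char0 phi).
suff fE : f = f.@[entries 1%:M] *: det ^+ s.
  rewrite !phiE ?leq_max ?leqnn ?orbT // fE !apolarZl.
  by rewrite -!mulrA; congr (_ * _); rewrite mulrC.
have [S [iota [iota_inj iotaC iota_unit]]] := rational_function_algebra k n.
pose X := generic_pt iota; pose fS := map_mpoly (in_alg S) f.
have detX : \det X = iota det by rewrite det_map_mx.
have XU : X^T \in unitmx.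
  by rewrite unitmx_tr unitmxE detX iota_unit ?generic_det_neq0.
have fS_size : (msize fS <= d)%N.
  exact: leq_trans (msize_map_mpoly _ _) (msize_dual_poly d phi).
have fS_inv : lin_subst (lmul_mx X) fS = \det X ^+ s *: fS.
  apply/mpolyP => m; have [md|dm] := ltnP (mdeg m) d; last first.
    (* f represents phi in degrees below d only, but beyond them both *)
    (* coefficients vanish. *)
    rewrite !memN_msupp_eq0 //; apply: msize_mdeg_ge.
      exact: leq_trans (leq_trans (msizeZ_le _ _) fS_size) dm.
    exact: leq_trans (leq_trans (msize_lin_subst _ _) fS_size) dm.
  have factU : (mfact m)%:R \is a @GRing.unit S.
    rewrite -(rmorph_nat (in_alg S)) rmorph_unit // unitfE; exact: mfact_neq0.
  (* Times m!, the coefficients at m are pairings with x^m. *)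
  apply: (mulIr factU); rewrite -[X in lmul_mx X]trmxK lmul_mx_tr -!apolarX.
  rewrite -apolar_lin_subst apolarZl -!(map_mpolyX (in_alg S)) -translateE.
  rewrite base_change_dual_poly //; last first.
    rewrite translateE; apply: leq_trans (msize_lin_subst _ _) _.
    by rewrite map_mpolyX msizeX.
  rewrite phi_inv // det_tr; congr (_ * _).
  by rewrite map_mpoly_apolar -phiE // msizeX.
have := congr1 (meval (entries 1%:M)) fS_inv.
rewrite meval_lin_subst meval_generic_pt // mevalZ detX.
have -> : fS.@[entries 1%:M] = iota (f.@[entries 1%:M])%:MP.
  rewrite iotaC -[RHS]/(in_alg S _) -meval_map_mpoly; apply: meval_eq => v.
  by rewrite /entries -(map_mx1 (in_alg S)) -map_mxvec mxE.
rewrite -rmorphXn -rmorphM => /iota_inj.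
by rewrite mulrC mul_mpolyC.
Qed.

End SemiInvariants.

(** * The invariant integral *)

Section InvariantIntegral.
Variables (k : fieldType) (n : nat).
Hypothesis char0 : [pchar k] =i pred0.
Local Notation P := {mpoly k[n * n]}.
Local Notation A := (gl_ring k n).
Local Notation det := (generic_det k n).
Local Notation c s := (apolar (det ^+ s) (det ^+ s)).

Lemma gl_fracE (f : A) : exists ps : P * nat, f == gl_frac ps.1 ps.2.
Proof.
have /gl_regularP[p [s fE]] := valP f.
by exists (p, s); apply/eqP/val_inj.
Qed.

Lemma gl_frac_eq (p q : P) s t :
  (gl_frac p s == gl_frac q t) = (p * det ^+ t == q * det ^+ s).
Proof.
rewrite -val_eqE /= eqr_div ?gl_det_neq0 //.
by rewrite -!tofracXn -!tofracM tofrac_eq.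
Qed.

Lemma gl_fracZD a (p q : P) s :
  a *: gl_frac p s + gl_frac q s = gl_frac (a *: p + q) s.
Proof.
rewrite -[a *: _]/(gl_frac a%:MP 0 * _); apply: val_inj.
rewrite rmorphD rmorphM /= expr0 divr1 mulrA -tofracM.
by rewrite -mulrDl -tofracD mul_mpolyC.
Qed.

Definition gl_integral_frac (p : P) (s : nat) : k := apolar (det ^+ s) p / c s.

(** The pairings of det^(s+t) with det^t p and of det^s with p are proportional
    as forms in p, and p = det^s gives the ratio of the two normalizations. *)
Lemma gl_integral_frac_mul_det p s t :
  gl_integral_frac (p * det ^+ t) (s + t) = gl_integral_frac p s.
Proof.
have E : apolar (det ^+ (s + t)) (det ^+ t * p) * c s =
    apolar (det ^+ (s + t)) (det ^+ t * det ^+ s) * apolar (det ^+ s) p.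
  exact: (semi_invariant_proportional char0
            (@det_pairing_semi_invariant k n s t)).
apply/eqP; rewrite eqr_div ?apolar_det_neq0 // [p * _]mulrC E.
by rewrite mulrC -exprD [(t + s)%N]addnC.
Qed.

Definition gl_integral (f : A) : k :=
  let ps := xchoose (gl_fracE f) in gl_integral_frac ps.1 ps.2.

Lemma gl_integral_fracE p s : gl_integral (gl_frac p s) = gl_integral_frac p s.
Proof.
rewrite /gl_integral; have := xchooseP (gl_fracE (gl_frac p s)).
set ps := xchoose _; rewrite gl_frac_eq => /eqP E.
rewrite -(gl_integral_frac_mul_det ps.1 ps.2 s) -E addnC.
exact: gl_integral_frac_mul_det.
Qed.

Fact gl_integral_is_scalar : scalar gl_integral.
Proof.
move=> a f g; have [[p s] /= /eqP->] := gl_fracE f.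
have [[q t] /= /eqP->] := gl_fracE g.
have -> : gl_frac p s = gl_frac (p * det ^+ t) (s + t).
  by apply/eqP; rewrite gl_frac_eq -mulrA -exprD addnC.
have -> : gl_frac q t = gl_frac (q * det ^+ s) (s + t).
  by apply/eqP; rewrite gl_frac_eq -mulrA -exprD addnC.
by rewrite gl_fracZD !gl_integral_fracE /gl_integral_frac linearP mulrDl mulrA.
Qed.

Lemma gl_frac_det s : gl_frac (det ^+ s) s = 1.
Proof. by apply: val_inj; rewrite rmorph1 /= tofracXn divff ?gl_det_neq0. Qed.

Lemma gl_integral1 : gl_integral 1 = 1.
Proof.
rewrite -(gl_frac_det 0) gl_integral_fracE /gl_integral_frac.
by rewrite divff ?apolar_det_neq0.
Qed.

(** A linear form on the coordinate ring is a family of forms on polynomials,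
    one for each power of det in the denominator; clearing denominators turns
    invariance into semi-invariance of weight s. *)
Lemma gl_invariantP (w : A -> k) :
  gl_invariant w <-> forall s, semi_invariant s (fun p => w (gl_frac p s)).
Proof.
split=> w_inv => [s S g gU p|S g gU p s].
  rewrite -(w_inv S g gU p s) mulVKr // unitrX // -unitmxE //.
have := w_inv s S g gU p; rewrite -[base_change _ _]/(extend_form w _ s) => ->.
by rewrite mulKr // unitrX -?unitmxE.
Qed.

Lemma gl_integral_invariant : gl_invariant gl_integral.
Proof.
apply/gl_invariantP => s S g gU p; rewrite gl_integral_fracE.
rewrite (base_change_mulr (fun q => gl_integral_fracE q s)).
by rewrite apolar_det_semi_invariant // -mulrA -!in_algE -rmorphM.
Qed.

Fact gl_frac_is_scalar (w : {scalar A}) s : scalar (fun p => w (gl_frac p s)).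
Proof. by move=> a p q; rewrite -gl_fracZD linearP. Qed.

(** On the fractions with denominator det^s, w is proportional to the pairing
    with det^s, and w(det^s / det^s) = 1 fixes the factor. *)
Lemma invariant_integral_unique (w : {scalar A}) :
  is_invariant_integral w -> w =1 gl_integral.
Proof.
case=> w1 /gl_invariantP w_inv f; have [[p s] /= /eqP->] := gl_fracE f.
pose phi_lin := GRing.isLinear.Build k P k *%R _ (gl_frac_is_scalar w s).
pose phi : {scalar P} := HB.pack (fun p => w (gl_frac p s)) phi_lin.
have := semi_invariant_proportional char0 (w_inv s : semi_invariant s phi) p.
rewrite /= gl_frac_det w1 mul1r gl_integral_fracE /gl_integral_frac => <-.
by rewrite mulfK ?apolar_det_neq0.
Qed.

End InvariantIntegral.

Theorem mainTheorem7 (k : fieldType) (n : nat) :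
  [pchar k] =i pred0 -> (0 < n)%N ->
  exists w : {scalar gl_ring k n},
    [/\ is_invariant_integral w,
        forall w' : {scalar gl_ring k n}, is_invariant_integral w' -> w' =1 w &
        forall (p : {mpoly k[n * n]}) (s : nat),
          w (gl_frac p s) =
            cayley_pow s (pihomog mdeg (n * s) p) /
            cayley_pow s (generic_det k n ^+ s)].
Proof.
move=> char0 _.
pose w_lin :=
  GRing.isLinear.Build k (gl_ring k n) k *%R _ (gl_integral_is_scalar char0).
pose w : {scalar gl_ring k n} := HB.pack (@gl_integral k n) w_lin.
exists w; split.
- by split; [apply: gl_integral1 | apply: gl_integral_invariant].
- exact: invariant_integral_unique.
move=> p s; rewrite !cayley_powE (apolar_homog _ (generic_det_homog _ _ _)).
exact: gl_integral_fracE.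
Qed.
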